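(* Let $\kappa\in(0,1)$, let $\nu$ be a $\kappa$-regular Borel probability measure on $\mathbb R$ such that $\hat\kappa_1(\nu)>1/2$, and let $K=\mathrm{supp}(\nu)$. Then: (a) there exist an effectively-computable $\varrho>0$ and $C>0$ such that $\mathcal N_K(T)\le C\,T^{2\kappa-\varrho}$ for all integers $T\ge1$; (b) there exists an effectively-computable $\varrho>0$ such that $\nu(W_K(2-\varrho))=0$.
   Context: A Borel measure $\nu$ on $\mathbb R$ is $\kappa$-regular (AD-regular with exponent $\kappa$) if there is a constant $C>1$ such that $C^{-1}r^\kappa\le\nu(B_r(x))\le Cr^\kappa$ for all $x\in\mathrm{supp}(\nu)$ and all sufficiently small $r>0$, where $B_r(x)$ is the interval of radius $r$ centred at $x$. Write $e(x)=e^{2\pi i x}$ and, for $\xi\in\mathbb Z$, $\hat\nu(\xi)=\int e(-\xi x)\,d\nu(x)$. The Fourier $\ell^1$ dimension is $\hat\kappa_1(\nu)=\sup\{s\ge0:\ \exists C_s \text{ with } \sum_{\xi=0}^Q|\hat\nu(\xi)|\le C_sQ^{1-s}\text{ for all } Q\ge1\}$. For compact $K$ and integer $T\ge1$, $\mathcal N_K(T)=\#\{x\in K: qx\in\mathbb Z\text{ for some integer }1\le q\le T\}$. For closed $K$ and $\alpha\ge1$, $W_K(\alpha)$ is the set of $x\in\mathbb R$ for which $|x-p/q|<q^{-\alpha}$ with $p/q\in K$ has infinitely many solutions $(p,q)\in\mathbb Z\times\mathbb N$. *)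

(* Defs.v *)
From HB Require Import structures.
From mathcomp Require Import all_boot all_order all_algebra.
From mathcomp Require Import all_classical all_reals all_analysis.
From mathcomp.real_closed Require Import complex.

Set Implicit Arguments.
Unset Strict Implicit.
Unset Printing Implicit Defensive.

Import Order.TTheory GRing.Theory Num.Theory.
Import numFieldNormedType.Exports.

Local Open Scope classical_set_scope.
Local Open Scope ring_scope.

Section FourierDimension.
Variable R : realType.
Implicit Types (nu : probability (measurableTypeR R) R) (K : set R).

Definition supp nu : set R :=
  [set x | forall U : set R, open U -> U x -> (0 < nu U)%E].

(* "Sufficiently small r" is uniform in x: for a probability measure this makes
   the support bounded, hence compact. *)
Definition AD_regular (kappa : R) nu : Prop :=
  exists C r0 : R, [/\ 1 < C, 0 < r0 &
    forall x r : R, supp nu x -> 0 < r < r0 ->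
      ((C^-1 * r `^ kappa)%:E <= nu (ball x r) <= (C * r `^ kappa)%:E)%E].

Definition e2pii (x : R) : R[i] := (cos (2 * pi * x) +i* sin (2 * pi * x))%C.

Definition complex_integral nu (f : R -> R[i]) : R[i] :=
  (\int[nu]_x complex.Re (f x) +i* \int[nu]_x complex.Im (f x))%C.

Definition fourier_coef nu (xi : int) : R[i] :=
  complex_integral nu (fun x => e2pii (- (xi%:~R * x))).

(* [ComplexField.Normc.normc] is the R-valued modulus. *)
Definition fourier_l1_dim nu : \bar R :=
  ereal_sup [set s%:E | s in [set s : R | 0 <= s /\
    exists C : R, forall Q : nat, (1 <= Q)%N ->
      \sum_(0 <= xi < Q.+1) ComplexField.Normc.normc (fourier_coef nu xi%:Z)
        <= C * Q%:R `^ (1 - s)]].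

(* [counting] is +oo on infinite sets. *)
Definition rational_count K (T : nat) : \bar R :=
  counting [set x : R | K x /\
    exists q : nat, (1 <= q <= T)%N /\ q%:R * x \is a Num.int].

Definition W_set K (alpha : R) : set R :=
  [set x : R | infinite_set [set pq : int * nat |
    [/\ (0 < pq.2)%N, K (pq.1%:~R / pq.2%:R) &
        `|x - pq.1%:~R / pq.2%:R| < pq.2%:R `^ (- alpha)]]].

End FourierDimension.

(* The total mu-recursive functions.  Each closure rule characterises the new
   function by its defining equations; in [recursive_min] the existence of [f]
   is exactly the totality of the minimisation. *)
Inductive recursive : forall n : nat, (n.-tuple nat -> nat) -> Prop :=
| recursive_zero n (f : n.-tuple nat -> nat) :
    (forall v, f v = 0%N) -> recursive f
| recursive_succ (f : 1.-tuple nat -> nat) :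
    (forall v, f v = (thead v).+1) -> recursive f
| recursive_proj n (i : 'I_n) (f : n.-tuple nat -> nat) :
    (forall v, f v = tnth v i) -> recursive f
| recursive_comp m n (g : m.-tuple nat -> nat) (h : 'I_m -> n.-tuple nat -> nat)
    (f : n.-tuple nat -> nat) :
    recursive g -> (forall i, recursive (h i)) ->
    (forall v, f v = g [tuple h i v | i < m]) -> recursive f
| recursive_prim n (g : n.-tuple nat -> nat) (h : n.+2.-tuple nat -> nat)
    (f : n.+1.-tuple nat -> nat) :
    recursive g -> recursive h ->
    (forall v : n.-tuple nat, f [tuple of 0%N :: v] = g v) ->
    (forall (v : n.-tuple nat) (m : nat), f [tuple of m.+1 :: v]
       = h [tuple of m :: f [tuple of m :: v] :: v]) ->
    recursive f
| recursive_min n (g : n.+1.-tuple nat -> nat) (f : n.-tuple nat -> nat) :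
    recursive g ->
    (forall v : n.-tuple nat, g [tuple of f v :: v] = 0%N /\
       forall m : nat, (m < f v)%N -> g [tuple of m :: v] <> 0%N) ->
    recursive f.

(* Computability on nonnegative rationals, presented as fractions of naturals;
   the values of [rho] at negative arguments are unconstrained. *)
Definition computable (rho : rat -> rat -> rat) : Prop :=
  exists num den : 4.-tuple nat -> nat, [/\ recursive num, recursive den &
    forall a b c d : nat, (0 < b)%N -> (0 < d)%N ->
      (0 < den [tuple a; b; c; d])%N /\
      rho (a%:R / b%:R) (c%:R / d%:R)
        = (num [tuple a; b; c; d])%:R / (den [tuple a; b; c; d])%:R].

(* Main.v *)
Require Import Defs.
From mathcomp Require Import all_boot all_order all_algebra.
From mathcomp Require Import all_classical all_reals all_analysis.
From mathcomp Require Import finmap measurable_realfun ring lra zify.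
From mathcomp.real_closed Require Import complex.
Import Order.TTheory GRing.Theory Num.Theory.
Import numFieldNormedType.Exports.
Local Open Scope classical_set_scope.
Local Open Scope ring_scope.

(* Fix T and N >= T^2.  The points of K with denominator at most T are
   T^-2-separated, so the balls of radius 1/(8N) around them are disjoint, each
   of nu-measure about N^-kappa.  The balls around multiples of 1/q lie where the
   Fejer-type kernel |sum_{m < N/q} e(m q x)|^2 is comparable to its maximum
   (N/q)^2; by Chebyshev this set has measure at most about
   (q/N) sum_{d < N/q} |nu^(d q)|.  Summing over q <= T, the divisor bound and the
   l^1 decay of nu^ give the total T^2/N + T N^(eps - s), hence
   #(points) <= C (T^2 N^(kappa - 1) + T N^(kappa + eps - s)).  As kappa < 1 and
   s > 1/2, taking N slightly larger than T^2 beats T^(2 kappa) by a power of T,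
   which is (a).  Part (b) is Borel-Cantelli over dyadic ranges of denominators. *)

(** * Computability of the exponent *)

Lemma recursive_comp1 (n : nat) (g : nat -> nat) (a : n.-tuple nat -> nat) :
  recursive (fun v : 1.-tuple nat => g (thead v)) ->
  recursive a -> recursive (fun v => g (a v)).
Proof.
move=> rg ra; apply: (recursive_comp rg (fun=> ra)) => v.
by rewrite /thead tnth_mktuple.
Qed.

Lemma recursive_const n (c : nat) : recursive (fun _ : n.-tuple nat => c).
Proof.
elim: c => [|c IH]; first exact: recursive_zero.
by apply: (@recursive_comp1 n succn) => //; exact: recursive_succ.
Qed.

Lemma recursive_comp2 (n : nat) (g : nat -> nat -> nat)
    (a b : n.-tuple nat -> nat) :
  recursive (fun v : 2.-tuple nat => g (thead v) (tnth v ord_max)) ->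
  recursive a -> recursive b -> recursive (fun v => g (a v) (b v)).
Proof.
move=> rg ra rb.
pose h (i : 'I_2) := if i == ord0 then a else b.
have rh i : recursive (h i) by rewrite /h; case: ifP.
apply: (recursive_comp rg rh) => v.
by rewrite /thead !tnth_mktuple.
Qed.

Lemma recursive_add (n : nat) (a b : n.-tuple nat -> nat) :
  recursive a -> recursive b -> recursive (fun v => a v + b v)%N.
Proof.
move=> ra rb.
apply: (@recursive_comp2 n addn) => //.
(* The step function receives the counter, the previous value and the parameter, in this order, so
   index 1 is the previous value. *)
pose i1 := Ordinal (isT : 1 < 3)%N.
apply: (@recursive_prim 1 (fun v => thead v) (fun v => (tnth v i1).+1)).
- exact: (@recursive_proj 1 ord0).
- by apply: (@recursive_comp1 3 succn);
    [exact: recursive_succ | exact: recursive_proj].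
- by move=> v; case/tupleP: v => x v; rewrite (tuple0 v).
- by move=> v m; case/tupleP: v => x v; rewrite (tuple0 v).
Qed.

Lemma recursive_mul (n : nat) (a b : n.-tuple nat -> nat) :
  recursive a -> recursive b -> recursive (fun v => a v * b v)%N.
Proof.
move=> ra rb.
apply: (@recursive_comp2 n muln) => //.
apply: (@recursive_prim 1 (fun v => 0%N)
  (fun v => tnth v ord_max + tnth v (Ordinal (isT : 1 < 3)))%N).
- exact: recursive_zero.
- by apply: recursive_add; exact: recursive_proj.
- by move=> v; case/tupleP: v => x v; rewrite (tuple0 v).
- by move=> v m; case/tupleP: v => x v; rewrite (tuple0 v).
Qed.

Lemma recursive_pred (n : nat) (a : n.-tuple nat -> nat) :
  recursive a -> recursive (fun v => (a v).-1).
Proof.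
move=> ra.
have rp : recursive (fun v : 1.-tuple nat => (thead v).-1).
  apply: (@recursive_prim 0 (fun v => 0%N) (fun v => thead v)) => //.
  - exact: recursive_zero.
  - exact: (@recursive_proj 2 ord0).
exact: (@recursive_comp1 n predn).
Qed.

Lemma recursive_sub (n : nat) (a b : n.-tuple nat -> nat) :
  recursive a -> recursive b -> recursive (fun v => a v - b v)%N.
Proof.
move=> ra rb.
(* Primitive recursion runs on the first component, which has to be the subtrahend; hence the
   swap. *)
apply: (@recursive_comp2 n (fun x y => y - x)%N _ _ _ rb ra).
apply: (@recursive_prim 1 (fun v => thead v)
  (fun v => (tnth v (Ordinal (isT : 1 < 3)%N)).-1)).
- exact: (@recursive_proj 1 ord0).
- by apply: recursive_pred; exact: recursive_proj.
- by move=> v; case/tupleP: v => x v; rewrite (tuple0 v) /= subn0.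
- by move=> v m; case/tupleP: v => x v; rewrite (tuple0 v) /= subnS.
Qed.

(* The maxima match truncated subtraction on numerators, and s + 1 keeps the
   denominator positive for every nonnegative argument. *)
Definition rho_exponent (k s : rat) : rat :=
  Num.max (1 - k) 0 * Num.max (2 * s - 1) 0 / (8 * (s + 1)).

Lemma max_subr_nat (F : realDomainType) (m n : nat) :
  Num.max (m%:R - n%:R) 0 = (m - n)%:R :> F.
Proof.
case: (leqP n m) => h; first by rewrite natrB // max_l // subr_ge0 ler_nat.
by rewrite (eqP (ltnW h : (m - n == 0)%N)) max_r // subr_le0 ler_nat ltnW.
Qed.

Lemma computable_rho_exponent : computable rho_exponent.
Proof.
pose x i (h : (i < 4)%N) (v : 4.-tuple nat) := tnth v (Ordinal h).
pose a := x 0%N isT; pose b := x 1%N isT.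
pose c := x 2%N isT; pose d := x 3%N isT.
have [ra rb rc rd] : [/\ recursive a, recursive b, recursive c & recursive d].
  by split; exact: recursive_proj.
(* For k = a/b and s = c/d the factors d of 2 s - 1 and of s + 1 cancel. *)
exists (fun v => (b v - a v) * (2 * c v - d v))%N.
exists (fun v => b v * (8 * (c v + d v)))%N; split.
- apply: recursive_mul; apply: recursive_sub => //.
  by apply: recursive_mul => //; exact: recursive_const.
- apply: recursive_mul => //; apply: recursive_mul; first exact: recursive_const.
  exact: recursive_add.
move=> {ra rb rc rd}; rewrite {}/a {}/b {}/c {}/d {}/x => a b c d b0 d0.
rewrite !(tnth_nth 0%N) /=; split; first by rewrite !muln_gt0 b0 addn_gt0 d0 orbT.
have b0' : b%:R != 0 :> rat by rewrite pnatr_eq0 -lt0n.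
have d0' : d%:R != 0 :> rat by rewrite pnatr_eq0 -lt0n.
have cd0 : c%:R + d%:R != 0 :> rat.
  by rewrite -natrD pnatr_eq0 -lt0n addn_gt0 d0 orbT.
rewrite !natrM -!max_subr_nat natrM natrD /rho_exponent.
have maxM (m n : rat) : 0 < n -> Num.max (m / n) 0 = Num.max m 0 / n.
  by move=> n0; rewrite maxr_pMl ?invr_ge0 1?ltW // mul0r.
have -> : 1 - a%:R / b%:R = (b%:R - a%:R) / b%:R :> rat by field.
have -> : 2 * (c%:R / d%:R) - 1 = (2 * c%:R - d%:R) / d%:R :> rat by field.
rewrite !maxM ?ltr0n //; field.
by rewrite b0' d0' cd0.
Qed.

(** * The divisor bound *)

(** [divisors] folds over the prime decomposition: a factor p^e merges in e further lists, each as
    long as the one it starts from. *)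
Lemma size_divisors (n : nat) :
  size (divisors n) = (\prod_(f <- prime_decomp n) f.2.+1)%N.
Proof.
rewrite /divisors; elim: (prime_decomp n) => [|[p e] s IH] /=.
  by rewrite big_nil.
rewrite big_cons -IH /=; set l := foldr _ _ _.
elim: e => [|e IHe] /=; first by rewrite mul1n.
by rewrite size_merge size_cat size_map IHe -mulSnr.
Qed.

(** The quotient of the divisor count by n^eps is a product of factors (e + 1) / p^(eps e). For p >=
    [P] the factor is at most 1 since p^eps >= 2; for the at most [P] smaller primes it is at most
    [B]. *)
Lemma size_divisors_le (R : realType) (eps : R) : 0 < eps ->
  exists2 C : R, 0 < C &
    forall n : nat, (0 < n)%N -> (size (divisors n))%:R <= C * n%:R `^ eps.
Proof.
move=> eps0.
have l2 : 0 < ln (2 : R) by rewrite ln_gt0 // ltr1n.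
(* From 2^(eps e) >= 1 + e eps ln 2, this [B] gives e + 1 <= B 2^(eps e). *)
pose B : R := 1 + (eps * ln 2)^-1.
have B1 : 1 <= B by rewrite lerDl invr_ge0 ltW // mulr_gt0.
pose P := (Num.truncn ((2 : R) `^ eps^-1)).+1.
have P2 : 2 <= P%:R `^ eps.
  have -> : 2 = ((2 : R) `^ eps^-1) `^ eps.
    by rewrite -powRrM mulVf ?powRr1 // lt0r_neq0.
  rewrite ge0_ler_powR ?nnegrE ?powR_ge0 //; first exact: ltW.
  exact: ltW (truncnS_gt _).
have factor_le p e : (1 < p)%N ->
    e.+1%:R <= (if (p < P)%N then B else 1) * (p ^ e)%:R `^ eps.
  move=> p1; rewrite natrX -powR_mulrn // powRAC powR_mulrn ?powR_ge0 //.
  case: ltnP => pP; last first.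
    rewrite mul1r; apply: (@le_trans _ _ (2 ^+ e)).
      by rewrite -natrX ler_nat ltn_expl.
    rewrite lerXn2r ?nnegrE ?powR_ge0 // (le_trans P2) //.
    by rewrite ge0_ler_powR ?nnegrE ?ler_nat // ltW.
  have h : 1 + e%:R * (eps * ln 2) <= (p%:R `^ eps) ^+ e.
    apply: (@le_trans _ _ (((2 : R) `^ eps) ^+ e)); last first.
      rewrite lerXn2r ?nnegrE ?powR_ge0 // ge0_ler_powR ?nnegrE ?ler_nat //.
      exact: ltW.
    by rewrite /powR pnatr_eq0 /= -expRM_natl mulrC; exact: expR_ge1Dx.
  apply: le_trans (ler_wpM2l _ h); last by rewrite (le_trans _ B1).
  rewrite /B mulrDl mul1r mulrDr mulr1.
  rewrite (mulrC e%:R) mulrA mulVf ?mul1r ?gt_eqF ?mulr_gt0 //.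
  have : 0 <= (eps * ln 2)^-1 by rewrite invr_ge0 ltW // mulr_gt0.
  have : 0 <= (e%:R : R) * (eps * ln 2) by rewrite mulr_ge0 // ltW // mulr_gt0.
  by rewrite -natr1; lra.
exists (B ^+ P) => [|n n0]; first by rewrite exprn_gt0 // (lt_le_trans _ B1).
rewrite size_divisors {2}(prod_prime_decomp n0).
have uP : uniq (map fst (prime_decomp n)) by exact: primes_uniq.
have pP f : f \in prime_decomp n -> (1 < f.1)%N.
  by case: f => p e /mem_prime_decomp[/prime_gt1].
suff : (\prod_(f <- prime_decomp n) f.2.+1)%:R <=
    B ^+ count (fun f => f.1 < P)%N (prime_decomp n)
      * (\prod_(f <- prime_decomp n) f.1 ^ f.2)%:R `^ eps.
  move=> /le_trans; apply; rewrite ler_wpM2r ?powR_ge0 // ler_weXn2l //.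
  rewrite -(count_map fst (fun x => x < P)%N) -size_filter -[leqRHS](size_iota 0).
  apply: uniq_leq_size; first exact: filter_uniq.
  by move=> x; rewrite mem_filter mem_iota => /andP[].
elim: (prime_decomp n) pP => [|f s IH] fs.
  by rewrite !big_nil /= mul1r powR1.
rewrite !big_cons !natrM powRM // [count _ _]/= exprD mulrACA ler_pM //.
  by rewrite (le_trans (factor_le _ _ (fs f (mem_head _ _)))) //; case: ifP.
by apply: IH => g gs; apply: fs; rewrite inE gs orbT.
Qed.

(** A given m <= N occurs as d q once for each of its divisors q <= T. *)
Lemma sum_multiples_le (R : realType) (a : nat -> R) (T N : nat) :
  (forall m, 0 <= a m) ->
  \sum_(1 <= q < T.+1) \sum_(1 <= d < (N %/ q).+1) a (d * q)%N
    <= \sum_(1 <= m < N.+1) (size (divisors m))%:R * a m.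
Proof.
move=> a0.
have step q : (0 < q)%N -> \sum_(1 <= d < (N %/ q).+1) a (d * q)%N
    = \sum_(1 <= m < N.+1 | (q %| m)%N) a m.
  move=> q0.
  rewrite -(big_filter _ (fun m => q %| m)%N) /index_iota !subn1 /=.
  rewrite -(big_map (fun d => d * q)%N predT a); apply: perm_big.
  apply: uniq_perm.
  - by rewrite map_inj_uniq ?iota_uniq // => x y /eqP; rewrite eqn_pmul2r // => /eqP.
  - by rewrite filter_uniq // iota_uniq.
  move=> m; rewrite mem_filter mem_iota; apply/mapP/idP => [[d]|].
    rewrite mem_iota => /andP[d1 dN] ->; rewrite dvdn_mull //=.
    by rewrite muln_gt0 d1 q0 /= add1n ltnS -leq_divRL // -ltnS.
  move=> /andP[/dvdnP[d ->] /andP[m1 mN]]; exists d => //.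
  rewrite mem_iota; apply/andP; split.
    by move: m1; rewrite muln_gt0 => /andP[].
  by rewrite add1n ltnS leq_divRL // -ltnS.
rewrite big_nat; under eq_bigr => q /andP[q0 _] do rewrite step //.
rewrite -big_nat (exchange_big_dep predT) //=.
rewrite !big_nat; apply: ler_sum => m /andP[m0 _].
rewrite -big_filter big_const_seq count_predT iter_addr_0 -[leLHS]mulr_natl.
rewrite ler_wpM2r // ler_nat; apply: uniq_leq_size.
  by rewrite filter_uniq // iota_uniq.
by move=> q; rewrite mem_filter => /andP[qm _]; rewrite -dvdn_divisors.
Qed.

(** * Neighbourhoods of rationals via exponential sums *)

Lemma cos_addint (R : realType) (x : R) (z : int) :
  cos (x + 2 * pi * z%:~R) = cos x.
Proof.
have h n y : cos (y + 2 * pi * n%:R) = cos y :> R.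
  rewrite (_ : 2 * pi * n%:R = pi *+ 2 *+ n); first by rewrite (periodicn (@cosD2pi R)).
  by rewrite -[pi *+ 2]mulr_natl -[RHS]mulr_natr.
case: z => n; first exact: h.
by rewrite NegzE mulrNz mulrN -[LHS](h n.+1) subrK.
Qed.

Lemma cos_ge_cos1 (R : realType) (x : R) : `|x| <= 1 -> cos 1 <= cos x.
Proof.
move=> x1; rewrite -[cos x]cos_norm.
have p2 := pi_ge2 R.
by rewrite leNgt ltr_cos ?in_itv /= -?leNgt ?normr_ge0 //; lra.
Qed.

(* The squared modulus of the sum of e^{i m t} over m < M. *)
Definition dirichlet_sqr {R : realType} (M : nat) (t : R) : R :=
  (\sum_(0 <= m < M) cos (m%:R * t)) ^+ 2 + (\sum_(0 <= m < M) sin (m%:R * t)) ^+ 2.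

(** Under truncated subtraction (m - n) + (n - m) is |m - n|, which may replace m - n because the
    cosine is even. *)
Lemma dirichlet_sqrE (R : realType) (M : nat) (t : R) : dirichlet_sqr M t =
  \sum_(0 <= m < M) \sum_(0 <= n < M) cos (((m - n) + (n - m))%:R * t).
Proof.
rewrite /dirichlet_sqr !expr2 !mulr_suml -big_split /=.
apply: eq_bigr => m _; rewrite !mulr_sumr -big_split /=.
apply: eq_bigr => n _; rewrite -cosB -mulrBl.
case: (leqP m n) => mn.
  rewrite (eqP (mn : (m - n == 0)%N)) add0n natrB //.
  by rewrite -opprB mulNr cosN.
by rewrite (eqP (ltnW mn : (n - m == 0)%N)) addn0 natrB // ltnW.
Qed.

(** For fixed m, each distance below M is attained by at most two n. *)
Lemma sum_dist_le (R : realType) (b : nat -> R) (M : nat) :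
  (forall d, 0 <= b d) ->
  \sum_(0 <= m < M) \sum_(0 <= n < M) b ((m - n) + (n - m))%N
    <= 2 * M%:R * \sum_(0 <= d < M) b d.
Proof.
move=> b0; set S := \sum_(0 <= d < M) b d.
suff h m : (m < M)%N -> \sum_(0 <= n < M) b ((m - n) + (n - m))%N <= 2 * S.
  rewrite big_nat (le_trans (ler_sum _ (fun m hm => h m (proj2 (andP hm))))) //.
  by rewrite -big_nat sumr_const_nat subn0 -[leLHS]mulr_natl mulrCA mulrA.
have mono k : (k <= M)%N -> \sum_(0 <= d < k) b d <= S.
  by move=> kM; rewrite [leRHS](big_cat_nat (n := k)) //= lerDl sumr_ge0.
move=> mM; rewrite (big_cat_nat (n := m.+1)) //= mulr_natl mulr2n lerD //.
  rewrite big_nat_rev /= big_nat.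
  under eq_bigr => i /andP[_ im].
    rewrite (_ : (_ + _)%N = i); last by lia.
    over.
  by rewrite -big_nat; exact: mono.
rewrite -[m.+1]add0n big_addn.
rewrite (eq_bigr (fun i => b i.+1)); last by move=> i _; congr b; lia.
apply: (@le_trans _ _ (\sum_(0 <= i < (M - m.+1).+1) b i)); last by apply: mono; lia.
by rewrite big_nat_recl // lerDr.
Qed.

Lemma integrable_Rsum (d : measure_display) (T : measurableType d) (R : realType)
    (mu : {measure set T -> \bar R}) (I : Type) (s : seq I) (f : I -> T -> R) :
  (forall i, mu.-integrable setT (EFin \o f i)) ->
  mu.-integrable setT (EFin \o (fun x => \sum_(i <- s) f i x)).
Proof.
move=> fi.
have := @integrable_sum _ _ _ mu _ measurableT _ s predT _ (fun i _ => fi i).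
by congr (_.-integrable _ _); apply: funext => x /=; rewrite sumEFin.
Qed.

Lemma Rintegral_sum (d : measure_display) (T : measurableType d) (R : realType)
    (mu : {measure set T -> \bar R}) (I : Type) (s : seq I) (f : I -> T -> R) :
  (forall i, mu.-integrable setT (EFin \o f i)) ->
  \int[mu]_x (\sum_(i <- s) f i x) = \sum_(i <- s) \int[mu]_x f i x.
Proof.
move=> fi; elim: s => [|i s IH].
  rewrite big_nil /Rintegral; under eq_integral do rewrite big_nil.
  by rewrite integral0.
rewrite big_cons -IH -RintegralD //; last exact: integrable_Rsum.
by apply: eq_Rintegral => x _; rewrite big_cons.
Qed.

Lemma integrable_cos (R : realType) (nu : probability (measurableTypeR R) R)
  (c : R) : nu.-integrable setT (EFin \o (fun x => cos (c * x))).
Proof.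
apply: measurable_bounded_integrable => //.
- by rewrite (le_lt_trans (probability_le1 nu measurableT)) // ltry.
- apply: continuous_measurable_fun => x.
  apply: (@continuous_comp _ _ _ (fun x => c * x) cos).
    exact: mulrl_continuous.
  exact: continuous_cos.
- exists 1; split => // e e1 x _; apply: le_trans (ltW e1).
  by rewrite ler_norml cos_geN1 cos_le1.
Qed.

Definition fourier_abs {R : realType} (nu : probability (measurableTypeR R) R)
  (m : nat) : R := ComplexField.Normc.normc (fourier_coef nu m%:Z).

Lemma fourier_abs_ge0 (R : realType) (nu : probability (measurableTypeR R) R)
  (m : nat) : 0 <= fourier_abs nu m.
Proof. by rewrite /fourier_abs; case: fourier_coef => a b; exact: sqrtr_ge0. Qed.

(** As the cosine is even, the integral is the real part of the Fourier coefficient at m. *)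
Lemma Rintegral_cos_le (R : realType) (nu : probability (measurableTypeR R) R)
    (m : nat) :
  \int[nu]_x cos (2 * pi * m%:R * x) <=
fourier_abs nu m.
Proof.
rewrite /fourier_abs /fourier_coef /complex_integral /e2pii /=.
set I := \int[nu]_x cos _; set J := \int[nu]_x cos _; set K := \int[nu]_x _.
have -> : I = J.
  by apply: eq_Rintegral => x _; rewrite mulrN cosN mulrA.
by rewrite (le_trans (ler_norm _)) // -sqrtr_sqr ler_wsqrtr // lerDl sqr_ge0.
Qed.

(* A measurable stand-in for the 1/(8 M q)-neighbourhood of the multiples of 1/q,
   which it contains. *)
Definition resonance_set (R : realType) (M q : nat) : set R :=
  [set x | (cos 1 * M%:R) ^+ 2 <= dirichlet_sqr M (2 * pi * q%:R * x)].

(** Integrated term by term, the double cosine sum yields real parts of Fourier coefficients at the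
    frequencies |m - n| q. *)
Lemma dirichlet_sqr_integral_le (R : realType)
    (nu : probability (measurableTypeR R) R) (M q : nat) :
  nu.-integrable setT
    (EFin \o (fun x => dirichlet_sqr M (2 * pi * q%:R * x))) /\
  \int[nu]_x dirichlet_sqr M (2 * pi * q%:R * x) <=
  2 * M%:R * \sum_(0 <= d < M)
    fourier_abs nu (d * q).
Proof.
pose F (mn : nat * nat) (x : R) := 
  cos (2 * pi * (((mn.1 - mn.2) + (mn.2 - mn.1)) * q)%:R * x).
have FE x : dirichlet_sqr M (2 * pi * q%:R * x) =
    \sum_(mn <- [seq (m, n) | m <- index_iota 0 M, n <- index_iota 0 M]) F mn x.
  rewrite dirichlet_sqrE big_allpairs.
  apply: eq_bigr => m _; apply: eq_bigr => n _.
  rewrite /F /=; congr cos.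
  by rewrite natrM; ring.
have Fi mn : nu.-integrable setT (EFin \o F mn) by exact: integrable_cos.
have -> : (fun x => dirichlet_sqr M (2 * pi * q%:R * x)) = _ := funext FE.
split; first exact: integrable_Rsum.
rewrite Rintegral_sum // big_allpairs.
apply: le_trans (@sum_dist_le R (fun d => fourier_abs nu (d * q)) M _); last first.
  by move=> d; exact: fourier_abs_ge0.
by apply: ler_sum => m _; apply: ler_sum => n _; exact: Rintegral_cos_le.
Qed.

Lemma measurable_resonance_set (R : realType) (M q : nat) :
  measurable (resonance_set R M q : set (measurableTypeR R)).
Proof.
rewrite (_ : resonance_set R M q = setT `&`
  (fun x => dirichlet_sqr M (2 * pi * q%:R * x)) @^-1`
    `[(cos 1 * M%:R) ^+ 2, +oo[); last first.
  rewrite setTI; apply/seteqP.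
  by split => x; rewrite /resonance_set /= in_itv /= andbT.
have ml (f : R -> R) : continuous f -> measurable_fun setT
    (fun x => \sum_(0 <= m < M) f (m%:R * (2 * pi * q%:R * x))).
  move=> cf; apply: measurable_sum => m.
  apply: continuous_measurable_fun => x.
  apply: (@continuous_comp _ _ _ (fun x => m%:R * (2 * pi * q%:R * x)) f);
    last exact: cf.
  apply: (@continuous_comp _ _ _ (fun x => 2 * pi * q%:R * x)
    (fun x => m%:R * x)); exact: mulrl_continuous.
have mf : measurable_fun (setT : set R)
    (fun x : R => dirichlet_sqr M (2 * pi * q%:R * x)).
  by apply: measurable_funD; apply: measurable_funX; apply: ml;
    [exact: continuous_cos | exact: continuous_sin].
by apply: mf => //; exact: measurable_itv.
Qed.

(** As q x is an integer, for m < [N %/ q] the phase 2 pi m q y differs from a multiple of 2 pi by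
    at most 8 N |y - x| <= 1, so every cosine is at least cos 1; the sine sum is dropped. *)
Lemma ball_sub_resonance_set (R : realType) (N q : nat) (x : R) :
  (0 < q <= N)%N -> q%:R * x \is a Num.int ->
  ball x (8 * N%:R)^-1 `<=` resonance_set R (N %/ q) q.
Proof.
move=> /andP[q0 qN] /intrP[p xp] y; rewrite -ball_normE /= => xy.
rewrite /resonance_set /= /dirichlet_sqr.
set M := (N %/ q)%N.
have N0 : 0 < N%:R :> R by rewrite ltr0n (leq_trans q0).
apply: (@le_trans _ _ ((\sum_(0 <= m < M) cos (m%:R * (2 * pi * q%:R * y))) ^+ 2));
  last by rewrite lerDl sqr_ge0.
have c1 : 0 < cos 1 :> R by exact: cos1_gt0.
suff h : cos 1 * M%:R <= \sum_(0 <= m < M) cos (m%:R * (2 * pi * q%:R * y)).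
  by rewrite lerXn2r ?nnegrE ?(le_trans _ h) // mulr_ge0 // ltW.
have -> : cos 1 * M%:R = \sum_(0 <= m < M) cos 1 :> R.
  by rewrite sumr_const_nat subn0 mulr_natr.
rewrite !big_nat; apply: ler_sum => m /andP[_ mM].
have -> : m%:R * (2 * pi * q%:R * y) =
    2 * pi * (m%:R * q%:R * (y - x)) + 2 * pi * (m%:Z * p)%:~R.
  by rewrite intrM /= -xp; ring.
rewrite cos_addint; apply: cos_ge_cos1.
have p4 : pi / 2 < 2 := pihalf_lt2 R.
have p0 : 0 < pi := pi_gt0 R.
have mq : (m%:R * q%:R : R) <= N%:R.
  by rewrite -natrM ler_nat (leq_trans _ (leq_trunc_div N q)) // leq_mul2r ltnW ?orbT.
rewrite !normrM !normr_nat (gtr0_norm p0).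
have xy' : `|y - x| * (8 * N%:R) <= 1.
  by rewrite -ler_pdivlMr ?mul1r ?mulr_gt0 // -distrC ltW // distrC.
have ny := normr_ge0 (y - x).
apply: le_trans xy'.
apply: (@le_trans _ _ (8 * (N%:R * `|y - x|))); last by rewrite mulrA mulrC.
apply: ler_pM; [lra | by rewrite !mulr_ge0 | lra | by rewrite ler_wpM2r].
Qed.

(** Chebyshev's inequality: the kernel is at least (M cos 1)^2 on the set, and its integral is at
    most 2 M S. *)
Lemma resonance_set_le (R : realType) (nu : probability (measurableTypeR R) R)
    (N q : nat) : (0 < q <= N)%N ->
  (nu (resonance_set R (N %/ q) q) <=
    (4 / cos 1 ^+ 2 * (q%:R / N%:R) * \sum_(0 <= d < N %/ q)
      fourier_abs nu (d * q))%:E)%E.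
Proof.
move=> /andP[q0 qN]; set M := (N %/ q)%N; set A := resonance_set R M q.
set S := \sum_(0 <= d < _) _.
have mA : measurable (A : set (measurableTypeR R)) by exact: measurable_resonance_set.
have M0 : (0 < M)%N by rewrite divn_gt0.
have c1 : 0 < cos 1 :> R by exact: cos1_gt0.
have [fi fI] := @dirichlet_sqr_integral_le R nu M q; rewrite -/S in fI.
set f := fun x => _ in fi fI.
have t0 : 0 < (cos 1 * M%:R) ^+ 2 :> R by rewrite exprn_gt0 // mulr_gt0 // ltr0n.
have key : (nu A * ((cos 1 * M%:R) ^+ 2)%:E <= (2 * M%:R * S)%:E)%E.
  apply: (@le_trans _ _ (\int[nu]_x (f x)%:E)%E); last first.
    by rewrite -[leLHS]fineK ?lee_fin //; exact: integrable_fin_num.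
  rewrite -[A]setIT -integral_indic // muleC -ge0_integralZl //; last 2 first.
    by apply/measurable_EFinP; exact: measurable_indic.
    by rewrite lee_fin ltW.
  apply: ge0_le_integral => //.
  - by move=> x _; rewrite mule_ge0 // lee_fin ?ltW // indicE.
  - by apply: measurable_funeM; apply/measurable_EFinP; exact: measurable_indic.
  - by move/integrableP: fi => [].
  - move=> x _; rewrite -EFinM lee_fin indicE.
    case: (boolP (x \in A)) => [|_]; first by move=> /set_mem; rewrite mulr1.
    by rewrite mulr0 /f addr_ge0 // sqr_ge0.
have Af : nu A \is a fin_num by exact: fin_num_measure.
have S0 : 0 <= S by apply: sumr_ge0 => d _; exact: fourier_abs_ge0.
rewrite -(fineK Af) lee_fin; move: key.
rewrite -(fineK Af) -EFinM lee_fin -ler_pdivlMr //.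
move=> /le_trans; apply.
have MR : 0 < M%:R :> R by rewrite ltr0n.
have NR : 0 < N%:R :> R by rewrite ltr0n (leq_trans q0).
have -> : 2 * M%:R * S / (cos 1 * M%:R) ^+ 2 = 4 / cos 1 ^+ 2 * (2 * M%:R)^-1 * S.
  by field; rewrite !lt0r_neq0.
rewrite ler_wpM2r // ler_wpM2l ?divr_ge0 ?sqr_ge0 //.
(* Since q <= N, the floor [M] of N / q is at least N / (2 q); this doubles the constant. *)
rewrite -[leRHS]invf_div lef_pV2 ?posrE ?divr_gt0 ?mulr_gt0 ?ltr0n //;
  last exact: leq_trans qN.
rewrite ler_pdivrMr ?ltr0n // -!natrM ler_nat.
have := divn_eq N q; have := ltn_pmod N q0; rewrite -/M; nia.
Qed.

(** The terms d = 0 contribute at most Cs T. The others are regrouped by m = d q <= N, where the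
    divisor bound costs a factor N^eps over the l^1 bound. *)
Lemma sum_multiples_fourier_le (R : realType)
    (nu : probability (measurableTypeR R) R) (s eps Cs : R) : 0 < eps ->
  (forall Q : nat, (1 <= Q)%N ->
    \sum_(0 <= m < Q.+1) fourier_abs nu m <= Cs * Q%:R `^ (1 - s)) ->
  exists2 C : R, 0 < C & forall T N : nat, (1 <= T <= N)%N ->
    \sum_(1 <= q < T.+1) \sum_(0 <= d < N %/ q) fourier_abs nu (d * q)
      <= C * (T%:R + N%:R `^ (1 + eps - s)).
Proof.
move=> eps0 hs; have a0 := fourier_abs_ge0 R nu.
have [Cd Cd0 hd] := @size_divisors_le R eps eps0.
(* The case Q = 1 bounds the coefficient at 0 and shows that [Cs] is nonnegative. *)
have aC : fourier_abs nu 0 <= Cs.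
  have := hs 1%N isT; rewrite powR1 mulr1 big_nat_recl //; apply: le_trans.
  by rewrite lerDl sumr_ge0.
have Cs0 : 0 <= Cs by exact: le_trans aC.
exists (Cs + Cd * Cs + 1) => [|T N /andP[T1 TN]].
  by rewrite ltr_wpDl // addr_ge0 // mulr_ge0 // ltW.
have N0 : (0 < N)%N by exact: leq_trans TN.
have NR : N%:R != 0 :> R by rewrite pnatr_eq0 -lt0n.
have step q : (0 < q <= N)%N -> \sum_(0 <= d < N %/ q) fourier_abs nu (d * q) <=
    Cs + \sum_(1 <= d < (N %/ q).+1) fourier_abs nu (d * q).
  move=> /andP[q0 qN].
  have : (0 < N %/ q)%N by rewrite divn_gt0.
  case: (N %/ q)%N => // M _.
  rewrite big_ltn // mul0n lerD // [leRHS]big_nat_recr //= lerDl a0 //.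
apply: (@le_trans _ _ (\sum_(1 <= q < T.+1)
    (Cs + \sum_(1 <= d < (N %/ q).+1) fourier_abs nu (d * q)))).
  rewrite !big_nat; apply: ler_sum => q /andP[q0 qT]; apply: step.
  by rewrite q0 (leq_trans _ TN).
rewrite big_split /= sumr_const_nat subn1 /= -[Cs *+ _]mulr_natr.
have main : \sum_(1 <= q < T.+1) \sum_(1 <= d < (N %/ q).+1) fourier_abs nu (d * q)
    <= Cd * Cs * N%:R `^ (1 + eps - s).
  apply: le_trans (@sum_multiples_le R (fourier_abs nu) T N a0) _.
  apply: (@le_trans _ _ (\sum_(1 <= m < N.+1) Cd * N%:R `^ eps * fourier_abs nu m)).
    rewrite !big_nat; apply: ler_sum => m /andP[m0 mN].
    rewrite ler_wpM2r // (le_trans (hd _ m0)) // ler_pM2l //.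
    by rewrite ge0_ler_powR ?nnegrE ?ler_nat // ltW.
  rewrite -mulr_sumr -addrA (addrC eps) addrA powRD ?NR ?implybT //.
  rewrite -!mulrA ler_pM2l // mulrC mulrA ler_wpM2r ?powR_ge0 //.
  apply: le_trans (hs N N0).
  by rewrite [leRHS]big_ltn // lerDr.
rewrite mulrDr lerD ?(le_trans main) //.
  by rewrite ler_wpM2r // -addrA lerDl addr_ge0 // mulr_ge0 // ltW.
by rewrite ler_wpM2r ?powR_ge0 // addrAC lerDr addr_ge0.
Qed.

Lemma resonance_sum_le (R : realType)
    (nu : probability (measurableTypeR R) R) (s eps Cs : R) : 0 < eps ->
  (forall Q : nat, (1 <= Q)%N ->
    \sum_(0 <= m < Q.+1) fourier_abs nu m <= Cs * Q%:R `^ (1 - s)) ->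
  exists2 C : R, 0 < C & forall T N : nat, (1 <= T <= N)%N ->
    (\sum_(0 <= q < T) nu (resonance_set R (N %/ q.+1) q.+1)
      <= (C * (T%:R / N%:R * (T%:R + N%:R `^ (1 + eps - s))))%:E)%E.
Proof.
move=> eps0 hs; have [C C0 hC] := sum_multiples_fourier_le R nu s eps Cs eps0 hs.
have c1 : 0 < cos 1 :> R by exact: cos1_gt0.
have c0 : 0 < 4 / cos 1 ^+ 2 :> R by rewrite divr_gt0 // exprn_gt0.
exists (4 / cos 1 ^+ 2 * C) => [|T N /andP[T1 TN]]; first exact: mulr_gt0.
apply: (@le_trans _ _ (\sum_(0 <= q < T) (4 / cos 1 ^+ 2 * (T%:R / N%:R) *
    \sum_(0 <= d < N %/ q.+1) fourier_abs nu (d * q.+1))%:E)%E).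
  rewrite !big_nat; apply: lee_sum => q /andP[_ qT].
  apply: le_trans (resonance_set_le R nu N q.+1 _) _; first exact: leq_trans TN.
  rewrite lee_fin ler_wpM2r //; first by apply: sumr_ge0 => d _; exact: fourier_abs_ge0.
  by rewrite ler_pM2l // ler_wpM2r ?invr_ge0 // ler_nat.
rewrite sumEFin lee_fin -mulr_sumr.
have := hC T N; rewrite T1 TN => /(_ isT) h.
rewrite [leRHS](_ : _ = 4 / cos 1 ^+ 2 * (T%:R / N%:R) *
  (C * (T%:R + N%:R `^ (1 + eps - s)))); last by rewrite mulrACA.
rewrite ler_wpM2l //; first by rewrite mulr_ge0 ?divr_ge0 ?sqr_ge0.
by move: h; rewrite big_add1.
Qed.

(** * Separation of rationals and disjoint balls *)

(** The set counted by [rational_count], named so that it can be bounded through its finite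
    subsets. *)
Definition low_denominator {R : realType} (K : set R) (T : nat) : set R :=
  [set x : R | K x /\ exists q : nat, (1 <= q <= T)%N /\ q%:R * x \is a Num.int].

(** For denominators q and r the number q r (x - y) is a nonzero integer, and q r <= T^2. *)
Lemma low_denominator_separated (R : realType) (K : set R) (T : nat) (x y : R) :
  low_denominator K T x -> low_denominator K T y -> x != y ->
  1 <= T%:R ^+ 2 * `|x - y|.
Proof.
move=> [_ [q [/andP[q0 qT] xi]]] [_ [r [/andP[r0 rT] yi]]] xy.
have z : q%:R * r%:R * (x - y) \is a Num.int.
  rewrite mulrBr rpredB //; last by rewrite -mulrA rpredM // natr_int.
  by rewrite mulrAC rpredM // natr_int.
have := norm_intr_ge1 z; rewrite !mulf_neq0 ?pnatr_eq0 -?lt0n ?subr_eq0 //.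
move=> /(_ isT) /le_trans; apply.
rewrite normrM ler_wpM2r // normrM !normr_nat expr2.
by rewrite ler_pM // ler_nat.
Qed.

(** Two meeting balls would have centres closer than 1 / (4 N), against the separation 1 / T^2 >= 1
    / N. So the measures add up to that of the union, which the resonance sets cover. *)
Lemma low_denominator_balls_le (R : realType)
    (nu : probability (measurableTypeR R) R) (K : set R) (T N : nat)
    (F : {fset R}) : (1 <= T)%N -> (T ^ 2 <= N)%N ->
  [set` F] `<=` low_denominator K T ->
  (\sum_(x <- F) nu (ball x (8 * N%:R)^-1) <=
   \sum_(0 <= q < T) nu (resonance_set R (N %/ q.+1) q.+1))%E.
Proof.
move=> T1 TN FK.
have TN' : (T <= N)%N by apply: leq_trans TN; rewrite -{1}[T]muln1 leq_mul2l T1 orbT.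
have N0 : 0 < N%:R :> R by rewrite ltr0n (leq_trans T1).
have mb x : measurable (ball x (8 * N%:R)^-1 : set (measurableTypeR R)).
  exact: measurable_ball.
rewrite -measure_fbigsetU //; last first.
  move=> x y xF yF [z]; rewrite -!ball_normE /= => -[xz yz].
  apply/eqP; apply: contraT => xy.
  have := low_denominator_separated R K T x y (FK _ xF) (FK _ yF) xy.
  rewrite leNgt => /negP; case.
  have d : `|x - y| < 2 * (8 * N%:R)^-1.
    rewrite (le_lt_trans (ler_distD z _ _)) // mulr_natl mulr2n ltrD // distrC //.
  have T2 : (T%:R : R) ^+ 2 <= N%:R by rewrite -natrX ler_nat.
  apply: (@le_lt_trans _ _ (N%:R * `|x - y|)); first by rewrite ler_wpM2r.
  rewrite (@lt_le_trans _ _ (N%:R * (2 * (8 * N%:R)^-1))) ?ltr_pM2l //.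
  rewrite (_ : _ * _ = 1 / 4) ; last by field; rewrite lt0r_neq0.
  lra.
rewrite big_mkord; apply: (@content_subadditive _ _ _ nu _
  (fun q => resonance_set R (N %/ q.+1) q.+1)).
- by move=> k _; exact: measurable_resonance_set.
- by apply: bigsetU_measurable => x _; exact: mb.
rewrite -bigcup_fset => z [x /= xF xz].
have [_ [q [/andP[q1 qT] qx]]] := FK x xF.
rewrite -(bigcup_mkord T (fun q => resonance_set R (N %/ q.+1) q.+1)).
(* The family is indexed by the denominator minus one. *)
exists q.-1 => /=; first by rewrite prednK.
rewrite prednK //; apply: (@ball_sub_resonance_set R N q x) => //.
by rewrite q1 (leq_trans qT).
Qed.

(** * Counting rational points *)

(** Transfers powers of a real X to an integer N of comparable size; |e| treats both signs of the
    exponent at once. *)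
Lemma powR_comparable (R : realType) (B X N e : R) : 1 <= B -> 0 < X ->
  X <= N <= B * X -> N `^ e <= B `^ `|e| * X `^ e.
Proof.
move=> B1 X0 /andP[XN NB].
have B0 : 0 < B by exact: lt_le_trans B1.
have N0 : 0 < N by exact: lt_le_trans XN.
case: (leP 0 e) => e0.
  rewrite ger0_norm // -powRM ?(ltW B0) ?(ltW X0) //.
  by rewrite ge0_ler_powR ?nnegrE ?mulr_ge0 ?(ltW N0) ?(ltW B0) ?(ltW X0).
apply: (@le_trans _ _ (X `^ e)).
  rewrite -[e]opprK !(powRN _ (- e)) lef_pV2 ?posrE ?powR_gt0 //.
  by rewrite ge0_ler_powR ?nnegrE ?oppr_ge0 ?(ltW e0) ?(ltW N0) ?(ltW X0).
rewrite ler_peMl ?powR_ge0 // -[leLHS](powRr0 B).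
exact: ler_powR.
Qed.

(** Each ball has measure at least A^-1 (8 N)^-kappa, the lower bound on N keeping its radius below
    [r0]. Dividing the bound for the total measure by this gives the count. *)
Lemma count_low_denominator_le (R : realType) (kappa s eps Cs : R)
    (nu : probability (measurableTypeR R) R) :
  0 < kappa -> AD_regular kappa nu -> 0 < eps ->
  (forall Q : nat, (1 <= Q)%N ->
    \sum_(0 <= m < Q.+1) fourier_abs nu m <= Cs * Q%:R `^ (1 - s)) ->
  exists C r0 : R, [/\ 0 < C, 0 < r0 & forall T N : nat, (1 <= T)%N ->
    (T ^ 2 <= N)%N -> r0^-1 < N%:R -> forall F : {fset R},
    [set` F] `<=` low_denominator (supp nu) T ->
    #|` F|%:R <= C * (T%:R ^+ 2 * N%:R `^ (kappa - 1)
                      + T%:R * N%:R `^ (kappa + eps - s))].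
Proof.
move=> kappa0 [A [r0 [A1 r00 hA]]] eps0 hs.
have [C C0 hC] := resonance_sum_le R nu s eps Cs eps0 hs.
have A0 : 0 < A by exact: lt_trans A1.
exists (A * 8 `^ kappa * C), r0; split => //.
  by rewrite !mulr_gt0 // powR_gt0.
move=> T N T1 TN Nr F FK.
have TN' : (T <= N)%N by apply: leq_trans TN; rewrite -{1}[T]muln1 leq_mul2l T1 orbT.
have N0 : 0 < N%:R :> R by rewrite ltr0n (leq_trans T1).
have := low_denominator_balls_le R nu _ T N F T1 TN FK.
move=> /le_trans /(_ (hC T N _)); rewrite T1 TN' => /(_ isT) h.
have {h} : ((\sum_(x <- F) (A^-1 * (8 * N%:R)^-1 `^ kappa))%:E <=
    (C * (T%:R / N%:R * (T%:R + N%:R `^ (1 + eps - s))))%:E)%E.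
  apply: le_trans h; rewrite -sumEFin big_seq [leRHS]big_seq.
  apply: lee_sum => x xF; have [Kx _] := FK x xF.
  have : 0 < (8 * N%:R : R)^-1 < r0.
    rewrite invr_gt0 mulr_gt0 //= -[r0]invrK ltf_pV2 ?posrE ?invr_gt0 ?mulr_gt0 //.
    by rewrite (lt_le_trans Nr) // ler_peMl ?(ltW N0) // ler1n.
  by move=> /(hA x _ Kx) /andP[].
rewrite lee_fin big_const_seq count_predT iter_addr_0 -[leLHS]mulr_natr => h.
have p0 : 0 < A^-1 * (8 * N%:R)^-1 `^ kappa.
  by rewrite mulr_gt0 ?invr_gt0 ?powR_gt0 ?invr_gt0 ?mulr_gt0.
rewrite -(ler_pM2l p0) (le_trans h) //.
rewrite [(_^-1) `^ kappa](_ : _ = (8 `^ kappa * N%:R `^ kappa)^-1); last first.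
  rewrite -powRM ?(ltW N0) // -powR_inv1 ?mulr_ge0 ?(ltW N0) //.
  by rewrite powRAC powR_inv1 ?powR_ge0.
have n0 : N%:R != 0 :> R by rewrite lt0r_neq0.
rewrite (_ : kappa + eps - s = kappa + (1 + eps - s) - 1); last by ring.
rewrite !powRD ?n0 ?implybT // powRr1 ?(ltW N0) // powR_inv1 ?(ltW N0) //.
rewrite le_eqVlt; apply/orP; left; apply/eqP.
have k0 : N%:R `^ kappa != 0 by rewrite lt0r_neq0 // powR_gt0.
have k8 : 8 `^ kappa != 0 :> R by rewrite lt0r_neq0 // powR_gt0.
by field; rewrite n0 k0 k8 (lt0r_neq0 A0).
Qed.

Lemma count_low_denominator_power (R : realType) (kappa u rho : R)
    (nu : probability (measurableTypeR R) R) :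
  0 < kappa < 1 -> AD_regular kappa nu -> 0 < u ->
  ((2^-1 + u)%:E < fourier_l1_dim nu)%E -> rho <= u * (1 - kappa) ->
  exists2 C : R, 0 < C & forall (T : nat) (F : {fset R}), (1 <= T)%N ->
    [set` F] `<=` low_denominator (supp nu) T ->
    #|` F|%:R <= C * T%:R `^ (2 * kappa - rho).
Proof.
(* The supremum need not be attained: this picks an admissible s above 1/2 + u, and the surplus s -
   1/2 - u serves as the eps of the divisor bound. *)
move=> /andP[kappa0 kappa1] hA u0 /ereal_sup_gt[_ [s [s0 [Cs hs]] <-]].
rewrite lte_fin => su rhou.
have eps0 : 0 < s - (2^-1 + u) by rewrite subr_gt0.
have [C [r0 [C0 r00 hC]]] :=
  count_low_denominator_le R kappa s (s - (2^-1 + u)) Cs nu kappa0 hA eps0 hs.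
(* N is about T^(2 + 2u), and s - eps = 1/2 + u: both terms of the previous bound
   are then at most T^(2 kappa - u (1 - kappa)) up to a constant. *)
pose n0 := (Num.truncn r0^-1).+1.
(* [n0] exceeds 1 / r0, so each of its positive multiples is large enough for regularity; the 2
   absorbs the rounding up of X >= 1. *)
pose B : R := 2 * n0%:R.
have B1 : 1 <= B by rewrite /B -natrM ler1n muln_gt0.
pose e1 := kappa - 1; pose e2 := kappa + (s - (2^-1 + u)) - s.
exists (C * (B `^ `|e1| + B `^ `|e2|)) => [|T F T1 FK].
  by rewrite mulr_gt0 // addr_gt0 // powR_gt0 // (lt_le_trans _ B1).
have TR : 1 <= T%:R :> R by rewrite ler1n.
have T0 : T%:R != 0 :> R by rewrite pnatr_eq0 -lt0n.
pose X : R := T%:R `^ (2 + 2 * u).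
have XT2 : T%:R ^+ 2 <= X.
  by rewrite -powR_mulrn // ler_powR // lerDl mulr_ge0 // ltW.
have X1 : 1 <= X by rewrite (le_trans _ XT2) // exprn_ege1.
have X0 : 0 < X by exact: lt_le_trans X1.
pose N := (n0 * (Num.truncn X).+1)%N.
have n01 : 1 <= n0%:R :> R by rewrite ler1n.
have XN : X <= N%:R.
  rewrite /N natrM (le_trans (ltW (truncnS_gt X))) // ler_peMl //.
have NB : N%:R <= B * X.
  rewrite /N /B natrM mulrAC [leLHS]mulrC ler_pM2r ?(lt_le_trans _ n01) //.
  have /andP[tX _] := truncn_itv (ltW X0).
  by rewrite -natr1; lra.
have TN : (T ^ 2 <= N)%N by rewrite -(ler_nat R) natrX (le_trans XT2).
have Nr : r0^-1 < N%:R.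
  by rewrite (lt_le_trans (truncnS_gt _)) // ler_nat leq_pmulr.
apply: le_trans (hC T N T1 TN Nr F FK) _.
rewrite -mulrA ler_pM2l // mulrDl.
have h1 := @powR_comparable R B X N%:R e1 B1 X0 (introT andP (conj XN NB)).
have h2 := @powR_comparable R B X N%:R e2 B1 X0 (introT andP (conj XN NB)).
have XE e : X `^ e = T%:R `^ ((2 + 2 * u) * e) by rewrite /X -powRrM.
apply: lerD.
  apply: (@le_trans _ _ (T%:R ^+ 2 * (B `^ `|e1| * X `^ e1))).
    by rewrite ler_pM2l // exprn_gt0 // (lt_le_trans _ TR).
  rewrite mulrCA ler_wpM2l ?powR_ge0 // XE -powR_mulrn // -powRD ?T0 ?implybT //.
  (* The exponent on the left is 2 kappa - 2 u (1 - kappa). *)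
  rewrite ler_powR // /e1; nra.
apply: (@le_trans _ _ (T%:R * (B `^ `|e2| * X `^ e2))).
  by rewrite ler_pM2l // (lt_le_trans _ TR).
rewrite mulrCA ler_wpM2l ?powR_ge0 // XE -{1}[T%:R]powRr1 // -powRD ?T0 ?implybT //.
(* The exponent on the left is 2 kappa - u (3 - 2 kappa) - 2 u^2, and 3 - 2 kappa >= 1 - kappa. *)
rewrite ler_powR // /e2; nra.
Qed.

(** An infinite set has finite subsets of every size. *)
Lemma finite_low_denominator (R : realType) (K : set R) (T : nat) (M : R) :
  (forall F : {fset R}, [set` F] `<=` low_denominator K T -> #|` F|%:R <= M) ->
  finite_set (low_denominator K T).
Proof.
move=> h; apply: contrapT => /(infinite_set_fset (Num.truncn M).+1)[F FK sF].
have := le_trans (_ : (Num.truncn M).+1%:R <= #|` F|%:R) (h F FK).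
by rewrite ler_nat => /(_ sF); rewrite leNgt truncnS_gt.
Qed.

Lemma rational_count_le (R : realType) (K : set R) (T : nat) (M : R) :
  (forall F : {fset R}, [set` F] `<=` low_denominator K T -> #|` F|%:R <= M) ->
  (rational_count K T <= M%:E)%E.
Proof.
move=> h; have fin := finite_low_denominator R K T M h.
rewrite /rational_count /counting -/(low_denominator K T).
case: asboolP => // _; rewrite lee_fin; apply: h.
by rewrite fset_setK.
Qed.

(** * Intrinsic approximation *)

(** For r >= r0 the bound 1 <= (r / r0)^kappa suffices, nu being a probability. All radii are wanted
    because the first dyadic ranges may use large ones. *)
Lemma AD_regular_upper (R : realType) (kappa : R)
    (nu : probability (measurableTypeR R) R) : 0 < kappa -> AD_regular kappa nu ->
  exists2 A : R, 0 < A & forall x r : R, supp nu x -> 0 < r ->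
    (nu (ball x r) <= (A * r `^ kappa)%:E)%E.
Proof.
move=> kappa0 [A [r0 [A1 r00 hA]]].
have A0 : 0 < A by exact: lt_trans A1.
have p0 : 0 < r0 `^ kappa by rewrite powR_gt0.
exists (A + (r0 `^ kappa)^-1) => [|x r Kx r1]; first by rewrite addr_gt0 // invr_gt0.
case: (ltP r r0) => rr0.
  have /andP[_ /le_trans] := hA x r Kx (introT andP (conj r1 rr0)); apply.
  by rewrite lee_fin ler_wpM2r ?powR_ge0 // lerDl invr_ge0 ltW.
apply: le_trans (probability_le1 nu (measurable_ball x r)) _.
rewrite lee_fin mulrDl addrC -[leLHS]addr0 lerD // ?mulr_ge0 ?powR_ge0 ?(ltW A0) //.
rewrite mulrC ler_pdivlMr // mul1r.
by rewrite ge0_ler_powR ?nnegrE ?(ltW kappa0) ?(ltW r00) ?(ltW r1).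
Qed.

(** Expresses infinitude by countable quantifiers along an enumeration, which makes [W_set] a limsup
    of balls, hence measurable. *)
Lemma infinite_set_pickleP (T : countType) (A : set T) :
  infinite_set A <-> forall n : nat, exists2 x, A x & (n <= choice.pickle x)%N.
Proof.
split=> [Ainf n|h Afin].
  apply: contrapT => nx; apply: Ainf.
  apply: (@sub_finite_set _ _ (choice.pickle @^-1` `I_n)).
    move=> x Ax /=; rewrite ltnNge; apply/negP => nx'.
    by apply: nx; exists x.
  apply: finite_preimage; last exact: finite_II.
  by move=> x y _ _; exact: (pcan_inj choice.pickleK).
have [x Ax] := h (\max_(x <- fset_set A) choice.pickle x).+1.
apply/negP; rewrite -leqNgt; apply: (@leq_bigmax_seq _ _ predT) => //.
by rewrite in_fset_set //; exact: mem_set.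
Qed.

Lemma measurable_W_set (R : realType) (K : set R) (alpha : R) :
  measurable (W_set K alpha : set (measurableTypeR R)).
Proof.
pose P (pq : int * nat) := (0 < pq.2)%N /\ K (pq.1%:~R / pq.2%:R).
pose B (pq : int * nat) : set R :=
  ball (pq.1%:~R / pq.2%:R : R) (pq.2%:R `^ (- alpha)).
rewrite (_ : W_set K alpha =
  \bigcap_n \bigcup_(pq in [set pq | P pq /\ (n <= choice.pickle pq)%N]) B pq).
  apply: bigcapT_measurable => n.
  rewrite bigcup_mkcond; apply: countable_bigcupT_measurable => // pq.
  by case: ifP => _ //; exact: measurable_ball.
apply/seteqP; split => x.
  move=> /infinite_set_pickleP h n _; have [pq [q0 Kpq xpq] npq] := h n.
  by exists pq => //; rewrite /B -ball_normE /= distrC.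
move=> h; apply/infinite_set_pickleP => n.
have [pq [[q0 Kpq] npq]] := h n I; rewrite /B -ball_normE /= distrC => xpq.
by exists pq.
Qed.

Lemma finite_int_lt (m : nat) : finite_set [set p : int | (`|p|%N < m)%N].
Proof.
apply: (@sub_finite_set _ _ ((Posz @` `I_m) `|` (Negz @` `I_m))).
  case=> n /= nm; [by left; exists n | right; exists n => //].
  exact: ltnW.
by rewrite finite_setU; split; apply: finite_image; exact: finite_II.
Qed.

(** A solution p/q goes to the range 2^j <= q < 2^(j+1). If no range j >= n catches x, all solutions
    have q < 2^n and |p| < q (|x| + 1), which leaves finitely many. *)
Lemma W_set_dyadic (R : realType) (K : set R) (alpha : R) : 0 <= alpha ->
  W_set K alpha `<=` lim_sup_set (fun j : nat =>
    \bigcup_(y in low_denominator K (2 ^ j.+1)) ball y ((2 ^ j)%:R `^ (- alpha))).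
Proof.
move=> alpha0 x Wx n _; apply: contrapT => hn; apply: Wx.
pose m := (2 ^ n * (Num.truncn (`|x| + 1)).+1)%N.
apply: (@sub_finite_set _ _ ([set p : int | (`|p|%N < m)%N] `*` `I_(2 ^ n)));
  last first.
  by apply: finite_setX; [exact: finite_int_lt | exact: finite_II].
move=> [p q] /= [q0 Kpq xpq].
have mono (a b : nat) : (0 < a <= b)%N -> b%:R `^ (- alpha) <= a%:R `^ (- alpha) :> R.
  move=> /andP[a0 ab].
  rewrite !powRN lef_pV2 ?posrE ?powR_gt0 ?ltr0n ?(leq_trans a0) //.
  by rewrite ge0_ler_powR ?nnegrE ?ler_nat.
have qn : (q < 2 ^ n)%N.
  rewrite ltnNge; apply/negP => nq; apply: hn.
  have /andP[tq qt] := trunc_log_bounds (isT : 1 < 2)%N q0.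
  exists (trunc_log 2 q); first by rewrite /= trunc_log_max.
  exists (p%:~R / q%:R).
    split => //; exists q; split; first by rewrite q0 ltnW.
    by rewrite mulrC divfK ?intr_int // pnatr_eq0 -lt0n.
  rewrite -ball_normE /= distrC (lt_le_trans xpq) // mono // tq andbT.
  by rewrite expn_gt0.
split => //=.
have qR : 0 < q%:R :> R by rewrite ltr0n.
have x1 : `|x - p%:~R / q%:R| < 1.
  by rewrite (lt_le_trans xpq) // (le_trans (mono 1%N q q0)) // powR1.
have pq : `|p%:~R / q%:R| < `|x| + 1 :> R.
  rewrite -[p%:~R / q%:R](subKr x) (le_lt_trans (ler_normB _ _)) // ltrD2l //.
rewrite -(ltr_nat R) natr_absz intr_norm /m natrM.
move: pq; rewrite normrM normfV normr_nat ltr_pdivrMr // => /lt_le_trans; apply.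
rewrite mulrC ler_pM ?addr_ge0 ?ler_nat ?(ltnW qn) //.
by rewrite ltW // truncnS_gt.
Qed.

(** Lowering the exponent 2 by rho costs a factor 2^(j rho kappa) in the measure of a ball, less
    than the saving 2^(j rho) in the count. The measures are thus at most D z^j with z < 1, and the
    first Borel-Cantelli lemma applies. *)
Lemma W_set_null (R : realType) (kappa rho C : R)
    (nu : probability (measurableTypeR R) R) :
  0 < kappa < 1 -> AD_regular kappa nu -> 0 < rho <= 1 -> 0 < C ->
  (forall (T : nat) (F : {fset R}), (1 <= T)%N ->
    [set` F] `<=` low_denominator (supp nu) T ->
    #|` F|%:R <= C * T%:R `^ (2 * kappa - rho)) ->
  nu (W_set (supp nu) (2 - rho)) = 0%E.
Proof.
move=> /andP[kappa0 kappa1] hA /andP[rho0 rho1] C0 hC.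
have [A A0 hB] := AD_regular_upper R kappa nu kappa0 hA.
pose L j := low_denominator (supp nu) (2 ^ j.+1).
pose r j : R := (2 ^ j)%:R `^ (- (2 - rho)).
pose E j := \bigcup_(y in L j) ball y (r j).
have finL j : finite_set (L j).
  by apply: finite_low_denominator => F; apply: hC; rewrite expn_gt0.
have mE j : measurable (E j : set (measurableTypeR R)).
  by apply: fin_bigcup_measurable => // y _; exact: measurable_ball.
pose z : R := 2 `^ (- (rho * (1 - kappa))).
have rk : 0 < rho * (1 - kappa) by rewrite mulr_gt0 // subr_gt0.
have z0 : 0 < z by rewrite powR_gt0.
have z1 : z < 1.
  rewrite /z powRN invf_lt1 ?powR_gt0 //.
  have /(_ 1 2) := gt0_ltr_powR rk; rewrite powR1; apply; rewrite ?nnegrE //.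
  by rewrite ltr1n.
(* The last factor of [D] arises because denominators reach 2^(j+1) while the radius uses 2^j. *)
pose D := C * A * 2 `^ (2 * kappa - rho).
have D0 : 0 < D by rewrite !mulr_gt0 // powR_gt0.
have nuE j : (nu (E j) <= (D * z ^+ j)%:E)%E.
  have r0 : 0 < r j by rewrite powR_gt0 // ltr0n expn_gt0.
  apply: (@le_trans _ _ (\sum_(y \in L j) nu (ball y (r j)))%E).
    apply: content_sub_fsum => // y _; exact: measurable_ball.
  rewrite fsbig_finite //=.
  apply: (@le_trans _ _ (\sum_(y <- fset_set (L j)) (A * r j `^ kappa)%:E)%E).
    rewrite big_seq [leRHS]big_seq; apply: lee_sum => y.
    by rewrite in_fset_set // => /set_mem[Ky _]; exact: hB.
  rewrite sumEFin lee_fin big_const_seq count_predT iter_addr_0 -[leLHS]mulr_natl.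
  apply: (@le_trans _ _ (C * (2 ^ j.+1)%:R `^ (2 * kappa - rho) * (A * r j `^ kappa))).
    rewrite ler_wpM2r ?mulr_ge0 ?powR_ge0 ?(ltW A0) //.
    by apply: hC; rewrite ?expn_gt0 // fset_setK.
  rewrite le_eqVlt; apply/orP; left; apply/eqP.
  have -> : z ^+ j = (2 ^ j)%:R `^ (- (rho * (1 - kappa))).
    by rewrite natrX /z -powR_mulrn ?powR_ge0 // powRAC powR_mulrn.
  have j0 : (2 ^ j)%:R != 0 :> R by rewrite pnatr_eq0 -lt0n expn_gt0.
  have -> : - (rho * (1 - kappa)) = (2 * kappa - rho) + - (2 - rho) * kappa by ring.
  rewrite expnS natrM powRM //.
  rewrite (@powRD _ _ (2 * kappa - rho) (- (2 - rho) * kappa)) ?j0 ?implybT //.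
  rewrite powRrM -/(r j) /D.
  by ring.
have limE : nu (lim_sup_set E) = 0%E.
  apply: lim_sup_set_cvg0 => //.
  apply: (@le_lt_trans _ _ (D * (1 - z)^-1)%:E); last exact: ltry.
  apply: lime_le; first exact: is_cvg_nneseries.
  apply: nearW => n.
  apply: (@le_trans _ _ (\sum_(0 <= j < n) (D * z ^+ j)%:E)%E).
    by apply: lee_sum => j _; exact: nuE.
  rewrite sumEFin lee_fin; apply: geometric_le_lim; rewrite ?(ltW D0) //.
  by rewrite gtr0_norm.
apply/eqP; rewrite eq_le measure_ge0 andbT -limE; apply: le_measure.
- by apply: mem_set; exact: measurable_W_set.
- apply: mem_set; apply: bigcapT_measurable => n.
  by apply: bigcup_measurable => j _; exact: mE.
- by apply: W_set_dyadic; rewrite subr_ge0 (le_trans rho1) // ler1n.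
Qed.

(** * The exponent and the conclusion *)

(** With u = (s - 1/2) / 2 the exponent equals u (1 - k) / (2 (s + 1)); the denominator exceeds 1
    and keeps the value at most 1 however large s is. *)
Lemma rho_exponent_bounds (k s : rat) : 0 < k < 1 -> 2^-1 < s ->
  0 < rho_exponent k s <= 1 /\
  rho_exponent k s <= (s - 2^-1) / 2 * (1 - k).
Proof.
move=> /andP[k0 k1] s2.
have s1 : 0 < 8 * (s + 1) by lra.
have -> : rho_exponent k s = (1 - k) * (2 * s - 1) / (8 * (s + 1)).
  by rewrite /rho_exponent !max_l //; lra.
have p0 : 0 < (1 - k) * (2 * s - 1) by rewrite mulr_gt0 //; lra.
rewrite divr_gt0 //=; split; rewrite ler_pdivrMr //; first by nra.
have -> : (s - 2^-1) / 2 * (1 - k) * (8 * (s + 1)) =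
  (1 - k) * (2 * s - 1) * (2 * (s + 1)) by field.
by rewrite ler_peMr ?(ltW p0) //; lra.
Qed.

(* [rho_a] and [rho_b] are algorithms: from any rational k in [kappa, 1[ and any
   rational s in ]1/2, fourier_l1_dim nu] they output the exponents rho of parts
   (a) and (b). *)
Theorem theorem2p1 (R : realType) :
  exists rho_a rho_b : rat -> rat -> rat,
    computable rho_a /\ computable rho_b /\
    forall (kappa : R) (nu : probability (measurableTypeR R) R),
      0 < kappa < 1 -> AD_regular kappa nu ->
      ((2^-1 : R)%:E < fourier_l1_dim nu)%E ->
      forall k s : rat, kappa <= (ratr k : R) < 1 ->
        2^-1 < s -> ((ratr s : R)%:E <= fourier_l1_dim nu)%E ->
      (0 < rho_a k s /\
       exists C : R, 0 < C /\ forall T : nat, (1 <= T)%N ->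
         (rational_count (supp nu) T
            <= (C * T%:R `^ (2 * kappa - ratr (rho_a k s)))%:E)%E)
      /\
      (0 < rho_b k s <= 1 /\
       nu (W_set (supp nu) (2 - ratr (rho_b k s))) = 0%E).
Proof.
exists rho_exponent, rho_exponent; split; first exact: computable_rho_exponent.
split; first exact: computable_rho_exponent.
move=> kappa nu kappa01 hA _ k s /andP[kappak k1] s2 sdim.
have /andP[kappa0 kappa1] := kappa01.
have k01 : 0 < k < 1.
  by rewrite -(ltr0q R) -(ltr_rat R k) rmorph1 k1 (lt_le_trans kappa0).
have [rho01 rhole] := rho_exponent_bounds k s k01 s2.
have /andP[rho0 rho1] := rho01.
pose rho : R := ratr (rho_exponent k s).
(* Half of the gap goes into [u], so that 1/2 + u stays strictly below s. *)
pose u : R := ratr ((s - 2^-1) / 2).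
have u0 : 0 < u by rewrite ltr0q divr_gt0 // subr_gt0.
have sdim' : ((2^-1 + u)%:E < fourier_l1_dim nu)%E.
  apply: lt_le_trans sdim; rewrite lte_fin.
  rewrite (_ : 2^-1 + u = ratr (2^-1 + (s - 2^-1) / 2)); last first.
    by rewrite rmorphD /= fmorphV /= ratr_nat.
  by rewrite ltr_rat; lra.
have rhou : rho <= u * (1 - kappa).
  (* Overestimating kappa by k is harmless, as it only lowers 1 - kappa to 1 - k. *)
  apply: (@le_trans _ _ (u * (1 - ratr k))).
    by rewrite -(rmorph1 (ratr : rat -> R)) -rmorphB -rmorphM ler_rat.
  by rewrite ler_pM2l // lerD2l lerN2.
have [C C0 hC] := count_low_denominator_power R kappa u rho nu kappa01 hA u0 sdim' rhou.
split; split => //.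
  exists C; split => // T T1; apply: rational_count_le => F.
  exact: hC.
apply: (W_set_null R kappa rho C) => //.
by rewrite /rho ltr0q rho0 -(rmorph1 (ratr : rat -> R)) ler_rat.
Qed.
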